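(* Let $N_1,\dots,N_6$ be positive integers with $\prod_{h=1}^6N_h>1$, and put $\Sigma=\sum_{h=1}^6N_h$, $\Pi=\prod_{h=1}^6N_h$, $\Gamma_0=N_1N_3N_5+N_2N_4N_6$, $$\Gamma_1=N_1N_3+N_1N_4+N_1N_5+N_2N_4+N_2N_5+N_2N_6+N_3N_5+N_3N_6+N_4N_6,$$ $$p=\tfrac13(3\Gamma_1-\Sigma^2),\qquad q=\tfrac1{27}\bigl(-2\Sigma^3+9\Sigma\Gamma_1-27\Pi-27\Gamma_0-27\bigr),\qquad \Delta=q^2+\tfrac4{27}p^3.$$ Let $A=(A_{h,h'})_{1\le h,h'\le 6}$ be the matrix with $A_{h,h+1}=N_h$, $A_{h+1,h}=1$ for $1\le h\le5$, $A_{6,1}=N_6$, $A_{1,6}=1$, and all other entries $0$. If $\Delta\ge0$, then the Perron eigenvalue of $A$ is $$\lambda(A)=\sqrt{\tfrac13\Sigma+\sqrt[3]{\tfrac12\bigl(-q+\sqrt\Delta\bigr)}+\sqrt[3]{\tfrac12\bigl(-q-\sqrt\Delta\bigr)}}.$$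
   Context: Cube roots are real cube roots. The Perron eigenvalue of a non-negative irreducible square matrix is its spectral radius, which is an eigenvalue. *)

(* Defs.v *)
From mathcomp Require Import all_boot all_order all_algebra.
From mathcomp Require Import all_classical all_reals all_analysis.
From mathcomp Require Import complex.

Set Implicit Arguments.
Unset Strict Implicit.
Unset Printing Implicit Defensive.

Import Order.TTheory GRing.Theory Num.Theory.

Local Open Scope ring_scope.
Local Open Scope classical_set_scope.

(* [powR] is only meaningful on non-negative bases, hence the sign; [cbrtK]
   and the injectivity of cubing characterize [cbrt x]. *)
Definition cbrt (R : realType) (x : R) : R := Num.sg x * (`|x| `^ 3^-1).

Lemma cbrtK (R : realType) (x : R) : cbrt x ^+ 3 = x.
Proof.
rewrite /cbrt exprMn -[(_ `^ _) ^+ 3]powR_mulrn ?powR_ge0//.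
rewrite -powRrM mulVf ?pnatr_eq0// powRr1 ?normr_ge0//.
by rewrite exprSr sqr_sg -mulrA -numEsg; case: eqVneq => [->|_]; rewrite ?mulr0 ?mul1r.
Qed.

(* The eigenvalues are all the complex ones; [sup] is a maximum as soon as
   0 < n, the set being then finite and non-empty. *)
Definition spectral_radius (R : realType) (n : nat) (A : 'M[R]_n) : R :=
  sup [set ComplexField.Normc.normc z | z in
        [set z : R[i] | eigenvalue (map_mx (real_complex R) A) z]].

Definition perron_eigenvalue (R : realType) (n : nat) (A : 'M[R]_n) (a : R) :
    Prop :=
  eigenvalue A a /\ a = spectral_radius A.

(* N_1, ..., N_6 are the values of [N : nat -> nat] at 1, ..., 6; the other
   values of N are never used. *)

Definition Sigma (N : nat -> nat) : nat := (\sum_(1 <= h < 7) N h)%N.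

Definition Pi (N : nat -> nat) : nat := (\prod_(1 <= h < 7) N h)%N.

Definition Gamma0 (N : nat -> nat) : nat :=
  (N 1 * N 3 * N 5 + N 2 * N 4 * N 6)%N.

Definition Gamma1 (N : nat -> nat) : nat :=
  (N 1 * N 3 + N 1 * N 4 + N 1 * N 5 + N 2 * N 4 + N 2 * N 5 + N 2 * N 6
   + N 3 * N 5 + N 3 * N 6 + N 4 * N 6)%N.

Definition pcoef (R : realType) (N : nat -> nat) : R :=
  3^-1 * (3 * (Gamma1 N)%:R - (Sigma N)%:R ^+ 2).

Definition qcoef (R : realType) (N : nat -> nat) : R :=
  27^-1 * (- 2 * (Sigma N)%:R ^+ 3 + 9 * (Sigma N)%:R * (Gamma1 N)%:R
           - 27 * (Pi N)%:R - 27 * (Gamma0 N)%:R - 27).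

Definition Delta (R : realType) (N : nat -> nat) : R :=
  qcoef R N ^+ 2 + 4 / 27 * pcoef R N ^+ 3.

Definition cyc_entry (N : nat -> nat) (h h' : nat) : nat :=
  (if h' == h.+1 then N h
   else if h == h'.+1 then 1
   else if (h == 6) && (h' == 1) then N 6
   else if (h == 1) && (h' == 6) then 1
   else 0)%N.

(* Ordinals start at 0, the indices h, h' at 1. *)
Definition cyc_mx (R : realType) (N : nat -> nat) : 'M[R]_6 :=
  \matrix_(i < 6, j < 6) (cyc_entry N i.+1 j.+1)%:R.

(* Main.v *)
(* On the odd indices, A ^+ 2 acts as a 3x3 matrix B with positive entries,
   whose characteristic polynomial in y is the cubic that Cardano's formula
   solves after the shift y = t + Sigma / 3.  It has a root y with a positive
   eigenvector of B; there all the principal 2x2 minors of y - B are positive,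
   and their sum is the derivative of the cubic, so that y is a simple root.
   When Delta >= 0 the only possible simple real root is Cardano's.  The
   eigenvector lifts to a positive one of A for the eigenvalue sqrt y, which
   bounds the modulus of every eigenvalue of A. *)

Require Import Defs.
From mathcomp Require Import all_boot all_order all_algebra.
From mathcomp Require Import all_classical all_reals all_analysis.
From mathcomp Require Import complex ring lra.

Import Order.TTheory GRing.Theory Num.Theory.
Local Open Scope ring_scope.

(** Let [m] be the entrywise moduli of a left eigenvector for [z]. The triangle inequality gives
    [|z| m <= m A] entrywise. Pairing with [V] gives [|z| (m V) <= r (m V)], and [m V > 0]. *)
Lemma perron_eigenvalue_pos_eigenvector (R : realType) (n : nat)
    (A : 'M[R]_n.+1) (V : 'cV[R]_n.+1) (r : R) :
  (forall i j, 0 <= A i j) -> (forall i, 0 < V i 0) -> A *m V = r *: V ->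
  perron_eigenvalue A r.
Proof.
move=> A0 V0 AV.
have eigA : eigenvalue A r.
  rewrite eigenvalue_root_char rootE /char_poly -horner_evalE -det_map_mx.
  have -> : map_mx (horner_eval r) (char_poly_mx A) = r%:M - A.
    by apply/matrixP => i j; rewrite !mxE /horner_eval !hornerE hornerMn hornerX.
  apply/negPn/negP => d0.
  have U : (r%:M - A) \in unitmx by rewrite unitmxE unitfE.
  have := mulKmx U V; rewrite mulmxBl AV mul_scalar_mx subrr mulmx0.
  move=> /matrixP /(_ 0 0); rewrite mxE => V00.
  by have := V0 0; rewrite -V00 ltxx.
have r0 : 0 <= r.
  have := V0 0; have /matrixP/(_ 0 0) := AV; rewrite !mxE => rV V00.
  rewrite -(pmulr_lge0 _ V00) -rV; apply: sumr_ge0 => j _.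
  by rewrite mulr_ge0// ltW.
split=> //; rewrite /spectral_radius.
set S := (X in sup X).
have Sr : S r.
  exists (r%:C)%C.
    rewrite /= eigenvalue_root_char -map_char_poly.
    by rewrite fmorph_root -eigenvalue_root_char.
  by rewrite /= expr0n /= addr0 sqrtr_sqr ger0_norm.
have ubS : ubound S r.
  move=> _ [z /eigenvalueP[w wA w0] <-].
  pose m i := ComplexField.Normc.normc (w 0 i).
  have m0 i : 0 <= m i by rewrite /m; case: (w 0 i) => ? ?; exact: sqrtr_ge0.
  have mE i : ((m i)%:C)%C = `|w 0 i| by [].
  set s := \sum_i m i * V i 0.
  have s0 : 0 < s.
    rewrite lt0r sumr_ge0 ?andbT; last by move=> i _; rewrite mulr_ge0// ltW.
    apply: contraNneq w0 => s_0; apply/eqP/matrixP => i j.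
    rewrite mxE ord1; apply/eqP; rewrite -normr_eq0 -mE.
    have := psumr_eq0P _ s_0 => /(_ _ j isT) => h.
    have : m j * V j 0 = 0 by apply: h => k _; rewrite mulr_ge0// ltW.
    by move/eqP; rewrite mulf_eq0 (gt_eqF (V0 j)) orbF => /eqP ->.
  rewrite -(ler_pM2r s0).
  have step i : ComplexField.Normc.normc z * m i <= \sum_j m j * A j i.
    rewrite -ComplexField.Normc.normcM.
    have /matrixP/(_ 0 i) := wA; rewrite !mxE => <-.
    rewrite -lecR.
    rewrite [leLHS](_ : _ = `|\sum_j w 0 j * map_mx (real_complex R) A j i|) //.
    apply: le_trans (ler_norm_sum _ _ _) _.
    rewrite rmorph_sum /=; apply: ler_sum => j _.
    by rewrite mxE normrM rmorphM /= mE (ger0_norm (x := ((A j i)%:C)%C)) // lecR.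
  apply: (@le_trans _ _ (\sum_i (\sum_j m j * A j i) * V i 0)).
    rewrite mulr_sumr; apply: ler_sum => i _.
    by rewrite mulrA ler_pM2r.
  under eq_bigr do rewrite mulr_suml.
  rewrite exchange_big /= mulr_sumr le_eqVlt; apply/orP; left; apply/eqP.
  apply: eq_bigr => j _.
  have /matrixP/(_ j 0) := AV; rewrite !mxE => rV.
  rewrite mulrCA -rV mulr_sumr; apply: eq_bigr => i _.
  by rewrite mulrA.
apply/le_anti/andP; split.
  by apply: ub_le_sup => //; exists r.
by apply: ge_sup => //; exists r.
Qed.

Lemma sum_sqr34_eq0 (R : realFieldType) (x y : R) :
  x ^+ 2 + 3 / 4 * y ^+ 2 = 0 -> x = 0 /\ y = 0.
Proof.
move=> xy; have := sqr_ge0 x; have := sqr_ge0 y => y2 x2.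
by split; apply/eqP; rewrite -sqrf_eq0; apply/eqP; lra.
Qed.

Lemma expr3_inj (R : realFieldType) : injective (fun x : R => x ^+ 3).
Proof.
move=> a b /= ab.
(* The cofactor is [a ^+ 2 + a * b + b ^+ 2] with the square completed. *)
have /eqP : (a - b) * ((a + b / 2) ^+ 2 + 3 / 4 * b ^+ 2) = 0.
  by rewrite -[RHS](subrr (b ^+ 3)) -{1}ab; field.
rewrite mulf_eq0 => /orP[/eqP/subr0_eq //|/eqP/sum_sqr34_eq0[]]; lra.
Qed.

(* The quadratic cofactor [(t + (u + v) / 2) ^+ 2 + 3 / 4 * (u - v) ^+ 2] of
   [t - (u + v)] vanishes only when [t] is a double root. *)
Lemma cardano_simple_root (R : realType) (p q t : R) :
  let D := q ^+ 2 + 4 / 27 * p ^+ 3 in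
  0 <= D -> t ^+ 3 + p * t + q = 0 -> 3 * t ^+ 2 + p != 0 ->
  t = cbrt (2^-1 * (- q + Num.sqrt D)) + cbrt (2^-1 * (- q - Num.sqrt D)).
Proof.
move=> D D0 tE tN.
have := cbrtK (2^-1 * (- q + Num.sqrt D)).
have := cbrtK (2^-1 * (- q - Num.sqrt D)).
set v := cbrt _; set u := cbrt _ => vE uE.
have sE := sqr_sqrtr D0; set s := Num.sqrt D in sE vE uE.
(* Both sides have cube [(q ^+ 2 - D) / 4], and real cube roots are unique. *)
have uvE : u * v = - p / 3.
  apply: expr3_inj; rewrite /= exprMn uE vE.
  have -> : 2^-1 * (- q + s) * (2^-1 * (- q - s)) = 4^-1 * (q ^+ 2 - s ^+ 2)
    by field.
  by rewrite sE /D; field.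
have pE : p = - 3 * (u * v) by rewrite uvE; field.
have qE : q = - (u ^+ 3 + v ^+ 3) by rewrite uE vE; field.
(* With [p] and [q] in terms of [u] and [v], the cubic is [t ^+ 3 - 3 * u * v * t - (u ^+ 3 + v ^+
   3)], which vanishes at [u + v]. *)
have : (t - (u + v)) * ((t + (u + v) / 2) ^+ 2 + 3 / 4 * (u - v) ^+ 2) = 0.
  by rewrite -[RHS]tE pE qE; field.
move/eqP; rewrite mulf_eq0.
move=> /orP[/eqP/subr0_eq //|/eqP/sum_sqr34_eq0[t_uv /subr0_eq uv]].
case/eqP: tN; rewrite pE uv; have -> : t = - v by rewrite uv in t_uv; lra.
ring.
Qed.

(** The hypotheses give [a * u > b * v] and [d * v > c * u]; multiply them and cancel [u * v]. Here
    [u] and [v] stand for two entries of a positive eigenvector, [r] and [s] for the contributions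
    of the third. *)
Lemma pos_minor (R : realFieldType) (a b c d u v r s : R) :
  0 < b -> 0 < c -> 0 < u -> 0 < v -> 0 < r -> 0 < s ->
  a * u = b * v + r -> d * v = c * u + s -> 0 < a * d - b * c.
Proof.
move=> b0 c0 u0 v0 r0 s0 auE dvE.
rewrite -(pmulr_lgt0 _ (mulr_gt0 u0 v0)).
have -> : (a * d - b * c) * (u * v) = (a * u) * (d * v) - b * c * (u * v) by ring.
have -> : (a * u) * (d * v) - b * c * (u * v) = b * v * s + r * (c * u) + r * s.
  by rewrite auE dvE; ring.
by rewrite !(addr_gt0, mulr_gt0).
Qed.

(* The root is found beyond the largest root [m] of the lower right 2x2 minor,
   where all the cofactors of the first row of [y - B] are positive. *)
Lemma pos_matrix3_eigenvector (R : rcfType) (a b c d e f g h k : R) :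
  0 < a -> 0 < b -> 0 < c -> 0 < d -> 0 < e -> 0 < f -> 0 < g -> 0 < h ->
  0 < k ->
  exists y x1 x2 x3 : R, [/\ [/\ 0 < x1, 0 < x2 & 0 < x3],
    a * x1 + b * x2 + c * x3 = y * x1,
    d * x1 + e * x2 + f * x3 = y * x2,
    g * x1 + h * x2 + k * x3 = y * x3 &
    (y - a) * ((y - e) * (y - k) - f * h)
      - (b * (d * (y - k) + f * g) + c * (g * (y - e) + h * d)) = 0 /\
    0 < ((y - a) * (y - e) - b * d) + ((y - a) * (y - k) - c * g)
        + ((y - e) * (y - k) - f * h)].
Proof.
move=> a0 b0 c0 d0 e0 f0 g0 h0 k0.
have fh0 := mulr_gt0 f0 h0.
pose D := (e - k) ^+ 2 + 4 * (f * h).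
have D0 : 0 <= D by rewrite addr_ge0 ?sqr_ge0 ?mulr_ge0 // ltW.
pose s := Num.sqrt D.
have sE : s ^+ 2 = D by rewrite sqr_sqrtr.
have s0 : 0 <= s by exact: sqrtr_ge0.
pose m := (e + k + s) / 2.
have mE : (m - e) * (m - k) = f * h.
  have -> : (m - e) * (m - k) = (s ^+ 2 - (e - k) ^+ 2) / 4 by rewrite /m; field.
  by rewrite sE /D; field.
have s_e : `|e - k| < s.
  rewrite -(@ltr_pXn2r _ 2) ?nnegrE ?normr_ge0 //.
  by rewrite real_normK ?num_real // sE /D; lra.
have [em km] : e < m /\ k < m.
  by move: s_e; rewrite ltr_norml => /andP[? ?]; rewrite /m; split; lra.
pose M := a + b + c + d + e + f + g + h + k.
have mM : m <= M.
  have : s <= e + k + f + h + f + h.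
    rewrite -(@ler_pXn2r _ 2) ?nnegrE // ?sE /D; last by lra.
    have := mulr_gt0 e0 k0; have := mulr_gt0 e0 f0; have := mulr_gt0 e0 h0.
    have := mulr_gt0 k0 f0; have := mulr_gt0 k0 h0; have := sqr_ge0 f.
    have := sqr_ge0 h; nra.
  rewrite /m /M; lra.
pose P : {poly R} := ('X - a%:P) * (('X - e%:P) * ('X - k%:P) - (f * h)%:P)
      - (b%:P * (d%:P * ('X - k%:P) + (f * g)%:P)
         + c%:P * (g%:P * ('X - e%:P) + (h * d)%:P)).
have PE y : P.[y] = (y - a) * ((y - e) * (y - k) - f * h)
      - (b * (d * (y - k) + f * g) + c * (g * (y - e) + h * d)).
  by rewrite /P !hornerE.
have cof y : m <= y ->
    0 < b * (d * (y - k) + f * g) + c * (g * (y - e) + h * d).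
  move=> my.
  have x2_gt0 : 0 < d * (y - k) + f * g.
    by rewrite addr_gt0 ?mulr_gt0 // subr_gt0; lra.
  have x3_gt0 : 0 < g * (y - e) + h * d.
    by rewrite addr_gt0 ?mulr_gt0 // subr_gt0; lra.
  by rewrite addr_gt0 ?mulr_gt0.
have Pm : P.[m] < 0 by rewrite PE mE subrr mulr0 sub0r oppr_lt0 cof.
have PM : 0 <= P.[M].
  rewrite PE.
  (* Obtained by splitting [M - a] as [b + c + (M - a - b - c)]. As [M] is the sum of all entries,
     each difference of products compares factor by factor. *)
  rewrite [leRHS](_ : _ = b * ((M - e - d) * (M - k) - f * (g + h))
    + c * ((M - k - g) * (M - e) - h * (f + d))
    + (M - a - b - c) * ((M - e) * (M - k) - f * h)); last by ring.
  by apply: addr_ge0; [apply: addr_ge0|]; apply: mulr_ge0;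
    rewrite ?subr_ge0 ?ler_pM // /M; lra.
have [y /andP[my _] /rootP Py] : exists2 y, m <= y <= M & root P y.
  by apply: poly_ivt => //; rewrite ltW /=.
have {my} my : m < y.
  by rewrite lt_neqAle my andbT; apply: contraTneq Pm => ->; rewrite Py ltxx.
have ye : 0 < y - e by lra.
have yk : 0 < y - k by lra.
(* The cofactors of the first row of [y - B]: they satisfy rows 2 and 3 identically, and row 1
   because [P.[y] = 0]. *)
pose x1 := (y - e) * (y - k) - f * h; pose x2 := d * (y - k) + f * g.
pose x3 := g * (y - e) + h * d.
have x1_gt0 : 0 < x1.
  by rewrite subr_gt0 -mE ltr_pM ?subr_ge0 ?ltrD2r // ltW.
have x2_gt0 : 0 < x2 by rewrite addr_gt0 ?mulr_gt0.
have x3_gt0 : 0 < x3 by rewrite addr_gt0 ?mulr_gt0.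
have E1 : a * x1 + b * x2 + c * x3 = y * x1.
  apply/eqP; rewrite -subr_eq0 -oppr_eq0 -[X in _ == X]Py PE.
  by apply/eqP; rewrite /x1 /x2 /x3; ring.
have E2 : d * x1 + e * x2 + f * x3 = y * x2 by rewrite /x1 /x2 /x3; ring.
have E3 : g * x1 + h * x2 + k * x3 = y * x3 by rewrite /x1 /x2 /x3; ring.
exists y, x1, x2, x3; split=> //; split; first by rewrite -PE.
(* The last minor is [x1] itself. *)
apply: addr_gt0 => //; apply: addr_gt0.
- by apply: (@pos_minor _ _ _ _ _ x1 x2 (c * x3) (f * x3));
    rewrite ?mulr_gt0 //; lra.
- by apply: (@pos_minor _ _ _ _ _ x1 x3 (b * x2) (h * x2));
    rewrite ?mulr_gt0 //; lra.
Qed.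

Theorem mainTheorem7 (R : realType) (N : nat -> nat)
  (N_gt0 : forall h : nat, (1 <= h <= 6)%N -> (0 < N h)%N)
  (Pi_gt1 : (1 < Pi N)%N)
  (Delta_ge0 : 0 <= Delta R N) :
  perron_eigenvalue (cyc_mx R N)
    (Num.sqrt (3^-1 * (Sigma N)%:R
               + cbrt (2^-1 * (- qcoef R N + Num.sqrt (Delta R N)))
               + cbrt (2^-1 * (- qcoef R N - Num.sqrt (Delta R N))))).
Proof.
have pos h : (1 <= h <= 6)%N -> 0 < (N h)%:R :> R by rewrite ltr0n; exact: N_gt0.
have n1 := pos 1%N isT; have n2 := pos 2%N isT; have n3 := pos 3%N isT.
have n4 := pos 4%N isT; have n5 := pos 5%N isT; have n6 := pos 6%N isT.
have SE : (Sigma N)%:R = (N 1)%:R + (N 2)%:R + (N 3)%:R + (N 4)%:R + (N 5)%:R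
    + (N 6)%:R :> R.
  by rewrite /Sigma unlock /= !natrD; ring.
have PE : (Pi N)%:R = (N 1)%:R * (N 2)%:R * (N 3)%:R * (N 4)%:R * (N 5)%:R
    * (N 6)%:R :> R.
  by rewrite /Pi unlock /= !natrM; ring.
(* The entries of [B] are the weights of the two-step walks between the indices 1, 3 and 5. Its
   trace is [Sigma], hence the shift below. *)
have [y [x1 [x3 [x5 [[x1_gt0 x3_gt0 x5_gt0] E1 E3 E5 [yE dE]]]]]] :=
  @pos_matrix3_eigenvector R ((N 1)%:R + (N 6)%:R) ((N 1)%:R * (N 2)%:R) 1
    1 ((N 2)%:R + (N 3)%:R) ((N 3)%:R * (N 4)%:R)
    ((N 5)%:R * (N 6)%:R) 1 ((N 4)%:R + (N 5)%:R)
    ltac:(by rewrite addr_gt0) ltac:(by rewrite mulr_gt0) ltr01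
    ltr01 ltac:(by rewrite addr_gt0) ltac:(by rewrite mulr_gt0)
    ltac:(by rewrite mulr_gt0) ltr01 ltac:(by rewrite addr_gt0).
set t := y - 3^-1 * (Sigma N)%:R.
have tE : t ^+ 3 + pcoef R N * t + qcoef R N = 0.
  rewrite -[RHS]yE /t /pcoef /qcoef PE /Gamma0 /Gamma1 SE !natrD !natrM.
  by field.
have tN : 3 * t ^+ 2 + pcoef R N != 0.
  rewrite gt_eqF //; apply: lt_le_trans dE _; rewrite le_eqVlt; apply/orP; left.
  by apply/eqP; rewrite /t /pcoef /Gamma1 SE !natrD !natrM; field.
rewrite [X in Num.sqrt X](_ : _ = y); last first.
  by rewrite -addrA -(@cardano_simple_root R _ _ _ Delta_ge0 tE tN) /t; ring.
have y0 : 0 < y.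
  by rewrite -(pmulr_lgt0 _ x1_gt0) -E1 ?(addr_gt0, mulr_gt0).
set r := Num.sqrt y.
have r0 : 0 < r by rewrite sqrtr_gt0.
have rE : r ^+ 2 = y by rewrite sqr_sqrtr // ltW.
(* The odd entries are [r] times the eigenvector of [B], the even ones are the image of that
   eigenvector under the even rows of [A]. The even rows of the eigenvalue equation then hold
   identically, and the odd ones reduce to [E1], [E3], [E5] and [r ^+ 2 = y]. *)
pose s : seq R := [:: r * x1; x1 + (N 2)%:R * x3; r * x3;
  x3 + (N 4)%:R * x5; r * x5; x5 + (N 6)%:R * x1].
apply: (@perron_eigenvalue_pos_eigenvector _ _ _ (\col_i s`_i)).
- by move=> i j; rewrite mxE ler0n.
- move=> i; rewrite mxE; case: i => [[|[|[|[|[|[|//]]]]]] ?] /=;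
  by rewrite ?(addr_gt0, mulr_gt0).
- apply/colP => i; rewrite !mxE !big_ord_recl big_ord0 !mxE /cyc_entry /bump /=.
  case: i => [[|[|[|[|[|[|//]]]]]] ?] /=.
  all: rewrite ?mulrA -?expr2 ?rE -?E1 -?E3 -?E5; ring.
Qed.
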